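(* There exist universal constants $A,a>0$ such that the following holds for every $\varepsilon\ge 0$, every positive integer $S$, every $P=(p_1,\dots,p_S)\in\mathcal{M}_S$ and every positive integer $n$. (i) $$\sup_{Q\in\mathcal{M}_S}\mathbb{E}_Q\big[|d_\varepsilon(P\|Q_n)-d_\varepsilon(P\|Q)|^2\big]\;\le\;A\left(\Big(\sum_{i=1}^S p_i\wedge\sqrt{\frac{e^\varepsilon p_i}{n}}\Big)^2+\frac{e^\varepsilon}{n}\right).$$ (ii) If $S\ge 2$, then $$\sup_{Q\in\mathcal{M}_S}\mathbb{E}_Q\big[|d_\varepsilon(P\|Q_n)-d_\varepsilon(P\|Q)|^2\big]\;\ge\;a\Big(\sum_{i=1}^S p_i\wedge\sqrt{\frac{e^\varepsilon p_i}{n}}\Big)^2.$$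
   Context: $\mathcal{M}_S$ is the set of probability distributions on $[S]=\{1,\dots,S\}$. $x\wedge y=\min\{x,y\}$ and $[x]^+=\max\{x,0\}$. For nonnegative vectors $P=(p_i)_{i=1}^S$, $Q=(q_i)_{i=1}^S$ (not necessarily summing to one), $d_\varepsilon(P\|Q)=\sum_{i=1}^S[p_i-e^\varepsilon q_i]^+$. Sampling model (Poisson sampling, expected sample size $n$): a random number $N\sim\mathrm{Poi}(n)$ of i.i.d. samples is drawn from $Q$, and $Q_n=(\hat q_1,\dots,\hat q_S)$, where $\hat q_i$ is the number of samples equal to $i$ divided by $n$ (not by $N$). Equivalently, $\hat q_1,\dots,\hat q_S$ are independent with $n\hat q_i\sim\mathrm{Poi}(nq_i)$. $P$ is known; $\mathbb{E}_Q$ is expectation over $Q_n$. The plug-in estimator is $d_\varepsilon(P\|Q_n)$. *)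

(* Defs.v *)
From HB Require Import structures.
From mathcomp Require Import all_boot all_order all_algebra.
From mathcomp Require Import all_classical all_reals all_analysis.

Set Implicit Arguments.
Unset Strict Implicit.
Unset Printing Implicit Defensive.

Import Order.TTheory GRing.Theory Num.Theory.
Import numFieldNormedType.Exports.

Local Open Scope classical_set_scope.
Local Open Scope ring_scope.

Section Divergence.
Context {R : realType} {S : nat}.
Implicit Types P Q : 'I_S -> R.

Definition simplex : set ('I_S -> R) :=
  [set P | (forall i, 0 <= P i) /\ \sum_(i < S) P i = 1].

Definition hockey_stick (eps : R) P Q : R :=
  \sum_(i < S) Num.max (P i - expR eps * Q i) 0.

End Divergence.

Section PoissonSampling.
Context {R : realType} {d : measure_display} {T : measurableType d} {S : nat}.
Variables (n : nat) (N : {mfun T >-> nat}) (X : nat -> T -> 'I_S).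

(* The samples are X 0, X 1, ..., X (N - 1). 'I_S has no measurableType
   structure in the library (it may be empty), so measurability of X j for the
   discrete sigma-algebra on 'I_S is stated by hand; accordingly all sets B and
   C j are allowed in the product rule, and taking some of them full covers
   every finite subfamily of N, X 0, X 1, ...
   The second argument of poisson_prob is a dummy. *)
Definition poisson_sampling (Pr : probability T R) (Q : 'I_S -> R) : Prop :=
  [/\ forall (j : nat) (C : set 'I_S), measurable (X j @^-1` C),
      forall B : set nat, distribution Pr N B = poisson_prob n%:R 0%N B,
      forall (j : nat) (i : 'I_S), Pr (X j @^-1` [set i]) = (Q i)%:E &
      forall (m : nat) (B : set nat) (C : nat -> set 'I_S),
        Pr (N @^-1` B `&` \bigcap_(j in `I_m) (X j @^-1` C j)) =
        (Pr (N @^-1` B) * \prod_(j < m) Pr (X j @^-1` C j))%E].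

(* Normalized by the expected sample size n, not by N w, so the total mass
   need not be 1. *)
Definition empirical (w : T) : 'I_S -> R :=
  fun i => (\sum_(j < N w) (X j w == i))%N%:R / n%:R.

End PoissonSampling.

(* Main.v *)
Require Import Defs.
From HB Require Import structures.
From mathcomp Require Import all_boot all_order all_algebra.
From mathcomp Require Import all_classical all_reals all_analysis.
From mathcomp Require Import measurable_realfun ring lra.

Set Implicit Arguments.
Unset Strict Implicit.
Unset Printing Implicit Defensive.

Import Order.TTheory GRing.Theory Num.Theory.
Import numFieldNormedType.Exports.

Local Open Scope classical_set_scope.
Local Open Scope ring_scope.

(* Let L = e^eps / n, let Z_i = n q^_i be the counts, lam_i = n q_i and
   f_i(z) = [p_i - L z]^+, so that the estimation error is the sum of the
   D_i = f_i(Z_i) - f_i(lam_i). Poisson splitting makes the Z_i pairwise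
   independent Poisson variables of mean lam_i.

   Upper bound. There is a constant C with C lam_i <= 2 p_i L and
   D_i^2 <= C (Z_i - lam_i)^2, hence E D_i^2 <= 2 p_i L; summing, the diagonal
   terms contribute at most 2 L. Since also |D_i| <= p_i, the bias |E D_i| is at
   most sqrt 2 * (p_i /\ sqrt (L p_i)), and the cross terms are products of biases.

   Lower bound. Take q_i = e^-eps p_i, except at an index i0 of minimal p_i which
   receives the remaining mass. Then the true divergence is 0, and by Jensen the
   risk is at least the square of the sum over i <> i0 of the
   E f_i(Z_i) = L E [lam_i - Z_i]^+. The latter mean telescopes to
   lam e^-lam lam^K / K! with K the integer part of lam, which is of order
   lam /\ sqrt lam by Stirling's bound. Dropping the smallest term of the rate
   costs at most a factor 2. *)

(** * Poisson weights *)

Section PoissonWeights.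
Context {R : realType}.
Implicit Types x y lam : R.

(** The function [f] is nonincreasing: its derivative is nonpositive because
    [1 - z <= expR (- z)]. *)
Lemma expR_le_pade y : 0 <= y -> (2 - y) * expR y <= 2 + y.
Proof.
pose f (z : R) : R := (2 - z) * expR z - z.
have df (z : R) : is_derive z 1 f ((1 - z) * expR z - 1).
  by apply: is_derive_eq; rewrite /GRing.scale /=; ring.
move=> y0; suff : f y <= f 0 by rewrite /f expR0; lra.
apply: (@ler0_derive1_nincry _ f 0) => //.
- move=> z _; rewrite derive1E derive_val.
  rewrite subr_le0 -(ler_pM2r (expR_gt0 (- z))) -mulrA expRxMexpNx_1 mulr1 mul1r.
  exact: expR_ge1Dx.
- by apply: derivable_within_continuous => z _; exact: ex_derive.
Qed.

(** Induction step of Stirling's bound. After a root of order [k = 2m + 1] it is the Padé bound at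
    [y = 2 / k], for which (2 + y) / (2 - y) = (m + 1) / m. *)
Lemma expR2_le_pow (m : nat) : (0 < m)%N ->
  expR 2 * m%:R ^+ (2 * m).+1 <= m.+1%:R ^+ (2 * m).+1 :> R.
Proof.
move=> m0; have m0' : 0 < m%:R :> R by rewrite ltr0n.
set k := (2 * m).+1; have k0 : 0 < k%:R :> R by rewrite ltr0n.
have kE : k%:R = 2 * m%:R + 1 :> R by rewrite /k -addn1 natrD natrM.
have -> : (2 : R) = k%:R * (2 / k%:R) by field; rewrite gt_eqF.
rewrite expRM_natl -exprMn; apply: lerXn2r; rewrite ?nnegrE ?mulr_ge0 ?expR_ge0 //.
have := @expR_le_pade (2 / k%:R); rewrite divr_ge0 // => /(_ isT).
have -> : 2 - 2 / k%:R = 4 * m%:R / k%:R :> R.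
  by rewrite kE; field; rewrite -kE gt_eqF.
have -> : 2 + 2 / k%:R = 4 * m.+1%:R / k%:R :> R.
  by rewrite -natr1 kE; field; rewrite -kE gt_eqF.
rewrite mulrAC ler_pM2r ?invr_gt0 // -!mulrA ler_pM2l //.
by rewrite mulrC.
Qed.

(* Stirling's bound [m! <= e * sqrt m * (m / e) ^ m], squared. *)
Lemma sqr_fact_le (m : nat) : (0 < m)%N ->
  (m`!%:R * expR m%:R) ^+ 2 <= expR 2 * m%:R ^+ (2 * m).+1 :> R.
Proof.
case: m => // m _; elim: m => [|m IH].
  have -> : 1`!%:R = 1 :> R by [].
    by rewrite mul1r expr1n mulr1 -expRM_natl mulr1.
set k := m.+1 in IH *.
have -> : (k.+1`!%:R * expR k.+1%:R) ^+ 2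
    = k.+1%:R ^+ 2 * expR 2 * (k`!%:R * expR k%:R) ^+ 2 :> R.
  rewrite factS natrM -[in expR k.+1%:R]natr1 expRD.
  have -> : expR 2 = expR 1 ^+ 2 :> R by rewrite -expRM_natl mulr1.
  by ring.
have -> : (2 * k.+1).+1 = (2 + (2 * k).+1)%N by rewrite mulnS addnS.
rewrite exprD; apply: le_trans (_ : k.+1%:R ^+ 2 * expR 2 * (expR 2 * k%:R ^+ (2 * k).+1) <= _).
  by rewrite ler_wpM2l // mulr_ge0 ?expR_ge0 // exprn_ge0.
by rewrite (mulrC (_ ^+ 2)) -!mulrA !ler_wpM2l ?expR_ge0 ?exprn_ge0 ?expR2_le_pow.
Qed.

Definition poisson_weight lam (k : nat) : R := expR (- lam) * (lam ^+ k / k`!%:R).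

Lemma poisson_weight_ge0 lam k : 0 <= lam -> 0 <= poisson_weight lam k.
Proof. by move=> l0; rewrite mulr_ge0 ?expR_ge0 // divr_ge0 ?exprn_ge0. Qed.

Lemma poisson_weightS lam k :
  k.+1%:R * poisson_weight lam k.+1 = lam * poisson_weight lam k.
Proof.
rewrite /poisson_weight factS natrM exprS; field.
by rewrite pnatr_eq0 -lt0n fact_gt0 /= addrC natr1 pnatr_eq0.
Qed.

(** Truncating the variance leaves an explicit boundary term, nonpositive as soon as [K >= lam]; the
    recurrence [poisson_weightS] drives the induction. *)
Lemma sum_poisson_weight_sqr lam K :
  \sum_(0 <= k < K.+1) (k%:R - lam) ^+ 2 * poisson_weight lam k =
  lam * \sum_(0 <= k < K) poisson_weight lam k
  + lam * (lam - K%:R) * poisson_weight lam K.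
Proof.
elim: K => [|K IH]; first by rewrite big_nat1 big_geq //; ring.
rewrite big_nat_recr //= IH [in RHS]big_nat_recr //=.
have E := poisson_weightS lam K.
set S := \sum_(_ <= _ < _) _.
have -> : lam * (lam - K%:R) * poisson_weight lam K =
  (lam - K%:R) * (K.+1%:R * poisson_weight lam K.+1) by rewrite E; ring.
have -> : lam * (S + poisson_weight lam K) =
  lam * S + (K.+1%:R * poisson_weight lam K.+1) by rewrite E; ring.
by rewrite -(natr1 K); ring.
Qed.

Lemma sum_poisson_weight_le1 lam K : 0 <= lam ->
  \sum_(0 <= k < K) poisson_weight lam k <= 1.
Proof.
move=> l0; rewrite -big_distrr /= expRN ler_pdivrMl ?expR_gt0 // mulr1.
have -> : \sum_(0 <= k < K) lam ^+ k / k`!%:R = series (exp_coeff lam) K.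
  by rewrite seriesEnat; apply: eq_bigr.
apply: nondecreasing_cvgn_le; last exact: is_cvg_series_exp_coeff.
by apply: nondecreasing_series => n _ _; rewrite exp_coeffE /= mulr_ge0 ?invr_ge0 ?exprn_ge0.
Qed.

Lemma sum_poisson_weight_sqr_le lam K : 0 <= lam ->
  \sum_(0 <= k < K) (k%:R - lam) ^+ 2 * poisson_weight lam k <= lam.
Proof.
(* Adding terms until the cutoff exceeds [lam] only increases the sum and makes the boundary term
   nonpositive. *)
move=> l0; set M := maxn K (Num.truncn lam).+1.
apply: (@le_trans _ _ (\sum_(0 <= k < M.+1) (k%:R - lam) ^+ 2 * poisson_weight lam k)).
  rewrite [leRHS](@big_cat_nat _ _ _ K) //=; last by rewrite (leq_trans (leq_maxl _ _) (leqnSn M)).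
  by rewrite lerDl sumr_ge0 // => k _; rewrite mulr_ge0 ?sqr_ge0 ?poisson_weight_ge0.
rewrite sum_poisson_weight_sqr.
apply: (@le_trans _ _ (lam * 1 + 0)); last by rewrite mulr1 addr0.
apply: lerD; first by rewrite ler_wpM2l // sum_poisson_weight_le1.
rewrite mulr_le0_ge0 ?poisson_weight_ge0 // mulr_ge0_le0 // subr_le0.
rewrite ltW // (lt_le_trans (truncnS_gt lam)) // ler_nat leq_maxr //.
Qed.

(** By [poisson_weightS], the k-th term is [lam] times the difference of the weights at k and k - 1,
    so the sum telescopes. *)
Lemma sum_poisson_weight_dev lam K :
  \sum_(0 <= k < K.+1) (lam - k%:R) * poisson_weight lam k =
  lam * poisson_weight lam K.
Proof.
elim: K => [|K IH]; first by rewrite big_nat1 subr0.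
by rewrite big_nat_recr //= IH -poisson_weightS; ring.
Qed.

(** The sum is the mean of [lam - Z]^+ for Z Poisson of mean [lam], and it telescopes to [lam] times
    the weight at K. If K = 0 this is [lam * expR (- lam)] with [lam < 1]; otherwise Stirling's
    bound gives a weight of at least e^-2 / sqrt lam. *)
Lemma poisson_mean_dev_ge lam : 0 <= lam ->
  expR (-2) * Num.min lam (Num.sqrt lam) <=
  \sum_(0 <= k < (Num.truncn lam).+1) (lam - k%:R) * poisson_weight lam k.
Proof.
move=> l0; rewrite sum_poisson_weight_dev; set K := Num.truncn lam.
have /andP[Kl lK] := truncn_itv l0; rewrite -/K in Kl lK.
case: (posnP K) => [K0|K0].
  rewrite K0 /poisson_weight expr0 fact0 divr1 mulr1 mulrC.
  apply: ler_pM => //; rewrite ?expR_ge0 ?ge_min ?lexx //.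
    by rewrite le_min l0 sqrtr_ge0.
  by rewrite ler_expR; move: lK; rewrite K0; lra.
have k0 : 0 < K%:R :> R by rewrite ltr0n.
have lp : 0 < lam by exact: lt_le_trans Kl.
have f0 : 0 < K`!%:R :> R by rewrite ltr0n fact_gt0.
have sl0 : 0 < Num.sqrt lam by rewrite sqrtr_gt0.
apply: (@le_trans _ _ (expR (-2) * Num.sqrt lam)).
  by rewrite ler_wpM2l ?expR_ge0 // ge_min lexx orbT.
rewrite -[X in X * poisson_weight _ _](sqr_sqrtr l0) mulrC expr2 -mulrA ler_pM2l //.
rewrite -ler_sqr ?nnegrE ?expR_ge0 //; last first.
  by rewrite mulr_ge0 ?sqrtr_ge0 // poisson_weight_ge0.
rewrite [leRHS]exprMn sqr_sqrtr // /poisson_weight.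
have -> : expR (-2) ^+ 2 = expR (-1) ^+ 2 * expR (-2) :> R.
  by rewrite -!expRM_natl -expRD; congr expR; ring.
have w0 x : 0 <= x -> 0 <= x ^+ K / K`!%:R by move=> x0; rewrite divr_ge0 ?exprn_ge0.
(* Rounding [lam] to K, and to K + 1 in the exponential, leaves only integers. The rounding costs a
   factor e^-1 and Stirling's bound another, which gives the constant e^-2. *)
apply: (@le_trans _ _ (K%:R * (expR (- (K%:R + 1)) * (K%:R ^+ K / K`!%:R)) ^+ 2)); last first.
  apply: ler_pM => //; rewrite ?sqr_ge0 //.
  rewrite ler_sqr ?nnegrE; [|by rewrite mulr_ge0 ?expR_ge0 ?w0..].
  apply: ler_pM; rewrite ?expR_ge0 ?w0 //.
    by rewrite ler_expR lerN2 natr1 ltW.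
  by rewrite ler_pM2r ?invr_gt0 // lerXn2r ?nnegrE.
rewrite (opprD K%:R) (expRD (- K%:R)).
have E := @sqr_fact_le K K0.
have -> : K%:R * (expR (- K%:R) * expR (-1) * (K%:R ^+ K / K`!%:R)) ^+ 2 =
  expR (-1) ^+ 2 * (K%:R ^+ (2 * K).+1 / (K`!%:R * expR K%:R) ^+ 2) :> R.
  rewrite expRN (exprS _ (2 * K)%N) (mulnC 2%N K) exprM; field.
  by rewrite !gt_eqF ?expR_gt0.
rewrite ler_pM2l ?exprn_gt0 ?expR_gt0 // ler_pdivlMr ?exprn_gt0 ?mulr_gt0 ?expR_gt0 //.
by rewrite expRN ler_pdivrMl ?expR_gt0.
Qed.

Lemma cvg_series_poisson_weight lam :
  series (poisson_weight lam) @ \oo --> (1 : R).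
Proof.
have -> : series (poisson_weight lam) = (fun K => expR (- lam) * series (exp_coeff lam) K).
  by apply/funext => K; rewrite !seriesEnat /= big_distrr.
rewrite -(expRxMexpNx_1 lam) mulrC; apply: cvgMr.
exact: is_cvg_series_exp_coeff.
Qed.

End PoissonWeights.

(** * Poisson splitting *)

Section Trinomial.
Context {R : realType}.
Variables (al be ga : R).

(* The probability that, among [k] independent trials, exactly [a] are of the
   first kind and [b] of the second. *)
Fixpoint trinomial (k a b : nat) : R :=
  if k is k'.+1 then
    (if a is a'.+1 then al * trinomial k' a' b else 0) +
    (if b is b'.+1 then be * trinomial k' a b' else 0) +
    ga * trinomial k' a b
  else ((a == 0) && (b == 0))%:R.

Lemma trinomial_small k a b : (k < a + b)%N -> trinomial k a b = 0.
Proof.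
elim: k a b => [|k IH] a b; first by case: a b => [|a] [|b].
rewrite /= => kab; rewrite (IH a b) ?mulr0 ?addr0; last exact: leq_trans kab.
case: a kab => [|a] kab; case: b kab => [|b] kab; rewrite ?IH ?mulr0 ?addr0 //.
- by rewrite addnS in kab.
Qed.

Lemma trinomialE a b c : trinomial (a + b + c) a b =
  (a + b + c)`!%:R * (al ^+ a / a`!%:R) * (be ^+ b / b`!%:R) * (ga ^+ c / c`!%:R).
Proof.
move En : (a + b + c)%N => k; elim: k a b c En => [|k IH] a b c.
  by case: a b c => [|a] [|b] [|c] //= _; rewrite !expr0 fact0 !divr1 !mulr1.
have e x m : m.+1%:R * (x ^+ m.+1 / m.+1`!%:R) = x * (x ^+ m / m`!%:R) :> R.
  rewrite factS natrM exprS; field.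
  by rewrite pnatr_eq0 -lt0n fact_gt0 /= addrC natr1 pnatr_eq0.
pose w x m : R := x ^+ m / m`!%:R.
move=> En; rewrite -[al ^+ a / _]/(w al a) -[be ^+ b / _]/(w be b) -[ga ^+ c / _]/(w ga c) /=.
(* The factor [a] covers the case [a = 0] as well. The three branches then differ only by the
   factors a, b and c, whose sum k + 1 turns k! into (k + 1)!. *)
have -> : (if a is a'.+1 then al * trinomial k a' b else 0) =
  k`!%:R * (a%:R * w al a) * w be b * w ga c.
  case: a En => [|a] En; first by rewrite !(mul0r, mulr0).
  by rewrite e (IH a b c) -?/(w _ _); [ring|case: En].
have -> : (if b is b'.+1 then be * trinomial k a b' else 0) =
  k`!%:R * w al a * (b%:R * w be b) * w ga c.
  case: b En => [|b] En; first by rewrite !(mul0r, mulr0).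
  by rewrite e (IH a b c) -?/(w _ _); [ring|move: En; rewrite addnS addSn => -[]].
have -> : ga * trinomial k a b = k`!%:R * w al a * w be b * (c%:R * w ga c).
  case: c En => [|c] En.
    by rewrite !(mul0r, mulr0) trinomial_small ?mulr0 // -En addn0.
  by rewrite e (IH a b c) -?/(w _ _); [ring|move: En; rewrite addnS => -[]].
by rewrite factS natrM -En !natrD; ring.
Qed.

(** Terms with m < a + b vanish. At m = a + b + c the exponential and the powers split, so the term
    is a product of three Poisson weights, and the weights in c sum to 1. *)
Lemma cvg_series_poisson_trinomial lam a b : al + be + ga = 1 ->
  series (fun m => poisson_weight lam m * trinomial m a b) @ \oo -->
  poisson_weight (lam * al) a * poisson_weight (lam * be) b.
Proof.
move=> abg; rewrite -(cvg_shiftn (a + b)).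
have E c : poisson_weight lam (a + b + c) * trinomial (a + b + c) a b =
  poisson_weight (lam * al) a * poisson_weight (lam * be) b
  * poisson_weight (lam * ga) c.
  rewrite trinomialE /poisson_weight.
  have -> : expR (- lam) =
      expR (- (lam * al)) * expR (- (lam * be)) * expR (- (lam * ga)).
    by rewrite -!expRD -!opprD -!mulrDr abg mulr1.
  rewrite !exprMn !exprD; field.
  by rewrite !pnatr_eq0 -!lt0n !fact_gt0.
set W := _ * _ in E *.
suff -> : (fun c => series (fun m => poisson_weight lam m * trinomial m a b)
    (c + (a + b))%N) = (fun c => W * series (poisson_weight (lam * ga)) c).
  have cvgW : (fun c => W * series (poisson_weight (lam * ga)) c) @ \oo --> W * 1.
    by apply: cvgMr; exact: cvg_series_poisson_weight.
  by rewrite mulr1 in cvgW.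
apply/funext => K; rewrite !seriesEnat /= (@big_cat_nat _ _ _ (a + b)) ?leq_addl //=.
rewrite big1_seq ?add0r => [|m]; last first.
  by rewrite mem_index_iota => /andP[_ mab]; rewrite trinomial_small ?mulr0.
rewrite -{1}[(a + b)%N]add0n big_addn addnK big_distrr /=.
by apply: eq_bigr => c _; rewrite addnC E.
Qed.

End Trinomial.

(** * Joint law of the counts of two disjoint sets of letters *)

Section TwoTypeCounts.
Context {R : realType} {d : measure_display} {T : measurableType d} {S : nat}.
Variables (n : nat) (N : {mfun T >-> nat}) (X : nat -> T -> 'I_S).
Variables (Pr : probability T R) (Q : 'I_S -> R).
Hypothesis NXQ : poisson_sampling n N X Pr Q.
Variables (A B : pred 'I_S) (al be : R).
Hypothesis AB0 : forall i, ~~ (A i && B i).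
Hypothesis PrA : forall j, Pr (X j @^-1` [set i | A i]) = al%:E.
Hypothesis PrB : forall j, Pr (X j @^-1` [set i | B i]) = be%:E.

Let ga : R := 1 - al - be.

Let prob_fin U : measurable U -> exists x : R, Pr U = x%:E.
Proof. by move=> mU; exists (fine (Pr U)); rewrite fineK ?fin_num_measure. Qed.

Let PrAB j : Pr (X j @^-1` [set i | ~~ A i && ~~ B i]) = ga%:E.
Proof.
have [mX _ _ _] := NXQ.
have -> : X j @^-1` [set i | ~~ A i && ~~ B i] =
    ~` (X j @^-1` [set i | A i] `|` X j @^-1` [set i | B i]).
  apply/seteqP; split=> w /=; first by move=> /andP[/negP nA /negP nB] [].
  by move=> nAB; apply/andP; split; apply/negP => h; apply: nAB; [left|right].
rewrite probability_setC; last exact: measurableU.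
rewrite measureU //; last first.
  apply/seteqP; split=> w //= [a b].
  by have := AB0 (X j w); rewrite a b.
transitivity (1 - (al%:E + be%:E))%E.
  by congr (_ - (_ + _))%E; [exact: PrA|exact: PrB].
by have -> : ga = 1 - (al + be) by rewrite /ga; ring.
Qed.

Let count (C : pred 'I_S) k w := (\sum_(j < k) C (X j w))%N.

(* The first [k] samples are counted, the next [m - k] are only required to lie
   in the sets [C j]; this freedom is what makes an induction on [k] possible. *)
Let event m k (D : set nat) a b (C : nat -> set 'I_S) : set T :=
  [set w | [/\ D (N w), count A k w = a, count B k w = b &
    forall j, (k <= j < m)%N -> C j (X j w)]].

Let upd k E (C : nat -> set 'I_S) : nat -> set 'I_S :=
  fun j => if j == k then E else C j.

(** Sample k is of the first kind, the second or neither; in each case this information moves from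
    the counts into the constraint at index k. *)
Let eventS m k D a b C : (k < m)%N -> event m k.+1 D a b C =
  (if a is a'.+1 then event m k D a' b (upd k [set i | A i] C) else set0) `|`
  (if b is b'.+1 then event m k D a b' (upd k [set i | B i] C) else set0) `|`
  event m k D a b (upd k [set i | ~~ A i && ~~ B i] C).
Proof.
move=> km; have updP E w :
  (forall j, (k <= j < m)%N -> upd k E C j (X j w)) <->
  E (X k w) /\ forall j, (k < j < m)%N -> C j (X j w).
  split=> [h|[h1 h2] j /andP[kj jm]].
    split=> [|j /andP[kj jm]]; first by have := h k; rewrite leqnn km /upd eqxx; apply.
    by have := h j; rewrite (ltnW kj) jm /upd gtn_eqF //; apply.
  rewrite /upd; case: eqP => [-> //|/eqP jk]; apply: h2.
  by rewrite jm andbT ltn_neqAle eq_sym jk.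
rewrite /event; apply/seteqP; split=> w /=.
  rewrite /count !big_ord_recr /= -/(count A k w) -/(count B k w) => -[Dw <- <- h].
  have := AB0 (X k w); case HA: (A (X k w)); case HB: (B (X k w)) => // _.
  - left; left; rewrite addn1 addn0; split=> //; apply/updP; split=> //=.
  - left; right; rewrite addn1 addn0; split=> //; apply/updP; split=> //=.
  - right; rewrite !addn0; split=> //; apply/updP; split=> //=.
    by rewrite HA HB.
rewrite /count !big_ord_recr /= -/(count A k w) -/(count B k w).
move=> [[|]|].
- case: a => // a [Dw <- <- /updP [/= HA h]]; split=> //.
    by rewrite HA addn1.
  by have := AB0 (X k w); rewrite HA /= => /negbTE ->; rewrite addn0.
- case: b => // b [Dw <- <- /updP [/= HB h]]; split=> //.
    by have := AB0 (X k w); rewrite HB /= andbT => /negbTE ->; rewrite addn0.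
  by rewrite HB addn1.
- by move=> [Dw <- <- /updP [/= /andP[/negbTE -> /negbTE ->] h]]; rewrite !addn0.
Qed.

(** For k = 0 this is the product rule for N and the samples. In the step, the three events of
    [eventS] are disjoint because they place sample k in disjoint sets, and their probabilities add
    up by the recursion of [trinomial]. *)
Let event_prob m k D a b C : (k <= m)%N ->
  measurable (event m k D a b C) /\
  Pr (event m k D a b C) = (Pr (N @^-1` D) * (trinomial al be ga k a b)%:E *
    \prod_(k <= j < m) Pr (X j @^-1` C j))%E.
Proof.
have [mX _ _ indep] := NXQ.
have mN U : measurable (N @^-1` U).
  by rewrite -[X in measurable X]setTI; exact: measurable_funPT.
elim: k a b C => [|k IH] a b C km.
  case ab0 : ((a == 0) && (b == 0))%N; last first.
    rewrite (_ : event _ _ _ _ _ _ = set0).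
      by rewrite measure0 /= ab0 mule0 mul0e.
    apply/seteqP; split=> w // [_]; rewrite /count !big_ord0 => a0 b0 _.
    by move: ab0; rewrite -a0 -b0.
  have -> : event m 0 D a b C = N @^-1` D `&` \bigcap_(j in `I_m) (X j @^-1` C j).
    move: ab0 => /andP[/eqP -> /eqP ->].
    apply/seteqP; split=> w /= => [[Dw _ _ h]|[Dw h]].
      by split.
    by split=> //; rewrite /count !big_ord0.
  split; last by rewrite indep /= ab0 mule1 big_mkord.
  apply: measurableI => //; apply: bigcap_measurableType => // j _; exact: mX.
set E1 := upd k [set i | A i] C; set E2 := upd k [set i | B i] C.
set E3 := upd k [set i | ~~ A i && ~~ B i] C.
rewrite eventS // -/E1 -/E2 -/E3.
(* All factors are finite; naming them as reals reduces the extended-real identities to [ring]. *)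
have [x xE] := prob_fin (mN D).
have [y yE] : exists y : R, (\prod_(k.+1 <= j < m) Pr (X j @^-1` C j))%E = y%:E.
  elim/big_ind : _ => [|_ _ [u ->] [v ->]|j _]; first by exists 1.
    by exists (u * v).
  exact: prob_fin.
have updE E e : Pr (X k @^-1` E) = e%:E ->
  (\prod_(k <= j < m) Pr (X j @^-1` upd k E C j) = (e * y)%:E)%E.
  move=> eE; rewrite big_ltn // {1}/upd eqxx eE EFinM -yE; congr (_ * _)%E.
  apply: eq_big_nat => j /andP[kj _]; by rewrite /upd gtn_eqF.
have IHE a' b' E e : Pr (X k @^-1` E) = e%:E ->
  measurable (event m k D a' b' (upd k E C)) /\
  Pr (event m k D a' b' (upd k E C)) = (x * trinomial al be ga k a' b' * (e * y))%:E.
  move=> eE; have [mE ->] := IH a' b' (upd k E C) (ltnW km).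
  by split=> //; rewrite (updE _ _ eE) xE -!EFinM.
have [m1 P1] : measurable (if a is a'.+1 then event m k D a' b E1 else set0) /\
    Pr (if a is a'.+1 then event m k D a' b E1 else set0) =
    (x * (if a is a'.+1 then al * trinomial al be ga k a' b else 0) * y)%:E.
  case: a => [|a]; first by rewrite measure0 mulr0 mul0r.
  have [mE ->] := IHE a b _ _ (PrA k).
  by split=> //; congr EFin; ring.
have [m2 P2] : measurable (if b is b'.+1 then event m k D a b' E2 else set0) /\
    Pr (if b is b'.+1 then event m k D a b' E2 else set0) =
    (x * (if b is b'.+1 then be * trinomial al be ga k a b' else 0) * y)%:E.
  case: b {m1 P1} => [|b]; first by rewrite measure0 mulr0 mul0r.
  have [mE ->] := IHE a b _ _ (PrB k).
  by split=> //; congr EFin; ring.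
have [m3 P3] := IHE a b _ _ (PrAB k).
have inE E a' b' w : event m k D a' b' (upd k E C) w -> E (X k w).
  by move=> [_ _ _] /(_ k); rewrite leqnn km /upd eqxx; apply.
split; first by apply: measurableU => //; exact: measurableU.
rewrite measureU //=; [|exact: measurableU|]; last first.
  apply/seteqP; split=> w // [[]].
    by case: a {m1 P1 m2 P2 m3 P3} => // a /inE /= HA /inE /=; rewrite HA.
  by case: b {m1 P1 m2 P2 m3 P3} => // b /inE /= HB /inE /=; rewrite HB andbF.
rewrite measureU //=; last first.
  apply/seteqP; split=> w // [].
  case: a {m1 P1 m2 P2 m3 P3} => // a /inE /= HA.
  case: b => // b /inE /= HB.
  by have := AB0 (X k w); rewrite HA HB.
transitivity ((x * (if a is a'.+1 then al * trinomial al be ga k a' b else 0) * y)%:E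
  + (x * (if b is b'.+1 then be * trinomial al be ga k a b' else 0) * y)%:E
  + (x * trinomial al be ga k a b * (ga * y))%:E)%E.
  by congr (_ + _ + _)%E; [exact: P1|exact: P2|exact: P3].
rewrite xE yE -!EFinM -!EFinD; congr EFin.
set u := match a with 0 => _ | _ => _ end; set v := match b with 0 => _ | _ => _ end.
by ring.
Qed.

(** Split according to the value m of N: each piece has probability [poisson_weight n%:R m] times a
    trinomial probability, and the series is summed by Poisson splitting. *)
Lemma two_type_count_prob a b : (0 < n)%N ->
  let E := [set w | (\sum_(j < N w) A (X j w))%N = a /\
                    (\sum_(j < N w) B (X j w))%N = b] in
  measurable E /\
  Pr E = (poisson_weight (n%:R * al) a * poisson_weight (n%:R * be) b)%:E.
Proof.
move=> n0 /=; have [_ PrN _ _] := NXQ.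
(* With k = m every sample is counted and no index is left to constrain. *)
pose F m := event m m [set m] a b (fun=> setT).
have -> : [set w | (\sum_(j < N w) A (X j w))%N = a /\
    (\sum_(j < N w) B (X j w))%N = b] = \bigcup_m F m.
  apply/seteqP; split=> w /=.
    by move=> [Aa Bb]; exists (N w) => //; split.
  by move=> [m _ [/= -> Aa Bb _]].
have mF m : measurable (F m) by have [] := @event_prob m m [set m] a b (fun=> setT) (leqnn m).
split; first exact: bigcupT_measurable.
rewrite measure_bigcup //; last first.
  by move=> i j _ _ [w [[/= Ni _ _ _] [/= Nj _ _ _]]]; rewrite -Ni -Nj.
under eq_eseriesl do rewrite in_setT.
have FE m : Pr (F m) = (poisson_weight n%:R m * trinomial al be ga m a b)%:E.
  have [_ ->] := @event_prob m m [set m] a b (fun=> setT) (leqnn m).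
  rewrite big_geq // mule1.
  have -> : Pr (N @^-1` [set m]) = (poisson_weight n%:R m)%:E.
    have := PrN [set m]; rewrite /distribution /pushforward => ->.
    rewrite /poisson_prob ltr0n n0 esum_set1 ?lee_fin ?poisson_pmf_ge0 //.
    by rewrite /poisson_pmf ltr0n n0 /poisson_weight mulrC.
  by rewrite EFinM.
rewrite (eq_eseriesr (fun m _ => FE m)).
apply/cvg_lim => //.
rewrite (_ : (fun _ => _) = EFin \o
    series (fun m => poisson_weight n%:R m * trinomial al be ga m a b)).
  apply: cvg_EFin; first exact: nearW.
  apply: cvg_series_poisson_trinomial; rewrite /ga; ring.
by apply/funext => K /=; rewrite seriesEnat /= sumEFin.
Qed.

End TwoTypeCounts.

(** * Expectations of bounded and discrete variables *)

Section BoundedExpectation.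
Context {R : realType} {d : measure_display} {T : measurableType d}.
Variable P : probability T R.
Implicit Types f g : T -> R.

(** Boundedness is stable under sums and products and implies integrability under a probability, so
    it settles the side conditions of linearity. *)
Definition bounded_rv f := measurable_fun setT f /\ exists M, forall w, `|f w| <= M.

Lemma integrable_bounded_rv f : bounded_rv f -> P.-integrable setT (EFin \o f).
Proof.
move=> [mf [M fM]]; apply: measurable_bounded_integrable => //.
  by rewrite ltey_eq fin_num_measure.
by exists M; split; [exact: num_real|move=> x Mx w _; exact: le_trans (fM w) (ltW Mx)].
Qed.

Lemma bounded_rv_cst (r : R) : bounded_rv (fun=> r).
Proof. by split; [exact: measurable_cst|exists `|r|]. Qed.

Lemma bounded_rvD f g : bounded_rv f -> bounded_rv g -> bounded_rv (fun w => f w + g w).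
Proof.
move=> [mf [M fM]] [mg [M' gM]]; split; first exact: measurable_funD.
by exists (M + M') => w; rewrite (le_trans (ler_normD _ _)) ?lerD.
Qed.

Lemma bounded_rvM f g : bounded_rv f -> bounded_rv g -> bounded_rv (fun w => f w * g w).
Proof.
move=> [mf [M fM]] [mg [M' gM]]; split; first exact: measurable_funM.
by exists (M * M') => w; rewrite normrM ler_pM.
Qed.

Lemma bounded_rvB f g : bounded_rv f -> bounded_rv g -> bounded_rv (fun w => f w - g w).
Proof.
move=> [mf [M fM]] [mg [M' gM]]; split; first exact: measurable_funB.
by exists (M + M') => w; rewrite (le_trans (ler_normB _ _)) ?lerD.
Qed.

Lemma bounded_rv_sum (I : Type) (s : seq I) (F : I -> T -> R) :
  (forall i, bounded_rv (F i)) -> bounded_rv (fun w => \sum_(i <- s) F i w).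
Proof.
move=> bF; elim: s => [|i s IH].
  by under eq_fun do rewrite big_nil; exact: bounded_rv_cst.
by under eq_fun do rewrite big_cons; exact: bounded_rvD.
Qed.

Lemma Rintegral_bounded_cst r : \int[P]_w r = r.
Proof. by rewrite Rintegral_cst // (congr1 fine (probability_setT P)) mulr1. Qed.

Lemma Rintegral_boundedD f g : bounded_rv f -> bounded_rv g ->
  \int[P]_w (f w + g w) = \int[P]_w f w + \int[P]_w g w.
Proof. by move=> bf bg; rewrite RintegralD //; exact: integrable_bounded_rv. Qed.

Lemma Rintegral_boundedB f g : bounded_rv f -> bounded_rv g ->
  \int[P]_w (f w - g w) = \int[P]_w f w - \int[P]_w g w.
Proof. by move=> bf bg; rewrite RintegralB //; exact: integrable_bounded_rv. Qed.

Lemma Rintegral_boundedZ r f : bounded_rv f ->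
  \int[P]_w (r * f w) = r * \int[P]_w f w.
Proof. by move=> bf; rewrite RintegralZl //; exact: integrable_bounded_rv. Qed.

Lemma Rintegral_bounded_sum (I : Type) (s : seq I) (F : I -> T -> R) :
  (forall i, bounded_rv (F i)) ->
  \int[P]_w (\sum_(i <- s) F i w) = \sum_(i <- s) \int[P]_w F i w.
Proof.
move=> bF; elim: s => [|i s IH].
  by under eq_Rintegral do rewrite big_nil; rewrite Rintegral_bounded_cst big_nil.
under eq_Rintegral do rewrite big_cons.
by rewrite big_cons Rintegral_boundedD ?IH //; exact: bounded_rv_sum.
Qed.

Lemma le_Rintegral_bounded f g : bounded_rv f -> bounded_rv g ->
  (forall w, f w <= g w) -> \int[P]_w f w <= \int[P]_w g w.
Proof.
by move=> bf bg fg; apply: le_Rintegral => //; exact: integrable_bounded_rv.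
Qed.

Lemma expectation_bounded_rv f : bounded_rv f -> 'E_P[f]%E = (\int[P]_w f w)%:E.
Proof.
move=> bf; rewrite unlock /Rintegral fineK //.
exact: (integrable_fin_num _ (integrable_bounded_rv bf)).
Qed.

(** Jensen's inequality for the square, from integrating [(f w - m) ^+ 2 >= 0] with m the mean. *)
Lemma sqr_Rintegral_le f : bounded_rv f ->
  (\int[P]_w f w) ^+ 2 <= \int[P]_w (f w ^+ 2).
Proof.
move=> bf; set m := \int[P]_w f w.
have bf2 : bounded_rv (fun w => f w ^+ 2) by exact: bounded_rvM.
have : 0 <= \int[P]_w (f w ^+ 2 - (2 * m * f w - m ^+ 2)).
  apply: Rintegral_ge0 => w _; rewrite (_ : _ - _ = (f w - m) ^+ 2) ?sqr_ge0 //; ring.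
have bmf : bounded_rv (fun w => 2 * m * f w).
  by apply: bounded_rvM => //; exact: bounded_rv_cst.
rewrite Rintegral_boundedB //; last by apply: bounded_rvB => //; exact: bounded_rv_cst.
rewrite Rintegral_boundedB //; last exact: bounded_rv_cst.
rewrite Rintegral_boundedZ // Rintegral_bounded_cst -/m; lra.
Qed.

(** Expand the square: diagonal terms are bounded by [V i], off-diagonal ones are products of means,
    at most [b i * b j]. Adding the nonnegative [b i * b i] completes the square of the sum of the
    b. *)
Lemma second_moment_sum_le (I : finType) (D : I -> T -> R) (V b : I -> R) :
  (forall i, bounded_rv (D i)) ->
  (forall i j, i != j ->
    \int[P]_w (D i w * D j w) = (\int[P]_w D i w) * \int[P]_w D j w) ->
  (forall i, \int[P]_w (D i w ^+ 2) <= V i) ->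
  (forall i, `|\int[P]_w D i w| <= b i) ->
  \int[P]_w ((\sum_i D i w) ^+ 2) <= \sum_i V i + (\sum_i b i) ^+ 2.
Proof.
move=> bD uncor DV Db.
have bDD i j : bounded_rv (fun w => D i w * D j w) by exact: bounded_rvM.
under eq_Rintegral do rewrite expr2 big_distrlr /=.
rewrite Rintegral_bounded_sum; last by move=> i; exact: bounded_rv_sum.
under eq_bigr do rewrite Rintegral_bounded_sum //.
rewrite [in leRHS]expr2 [in leRHS]big_distrlr /= -big_split /=.
apply: ler_sum => i _; rewrite (bigD1 i) //= [in leRHS](bigD1 i) //= addrA.
have b0 j : 0 <= b j by exact: le_trans (Db j).
apply: lerD; first by rewrite -[leLHS]addr0 lerD ?mulr_ge0 ?DV.
apply: ler_sum => j ji; rewrite uncor 1?eq_sym // (le_trans (ler_norm _)) //.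
by rewrite normrM ler_pM.
Qed.

End BoundedExpectation.

(** * Expectations of functions of integer-valued and Poisson variables *)

Section DiscreteExpectation.
Context {R : realType} {d : measure_display} {T : measurableType d}.
Variable P : probability T R.

Lemma measurable_fun_nat d' (U : measurableType d') (Z : T -> nat) (f : nat -> U) :
  (forall k, measurable (Z @^-1` [set k])) -> measurable_fun setT (fun w => f (Z w)).
Proof.
move=> mZ _ Y mY; rewrite setTI.
have -> : (fun w => f (Z w)) @^-1` Y = \bigcup_(k in [set k | Y (f k)]) (Z @^-1` [set k]).
  by apply/seteqP; split=> w /= => [Yf|[k /= Yk ->]] //; exists (Z w).
by apply: bigcup_measurable => k _; exact: mZ.
Qed.

Lemma bounded_rv_nat (Z : T -> nat) (f : nat -> R) :
  (forall k, measurable (Z @^-1` [set k])) -> (exists M, forall k, `|f k| <= M) ->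
  bounded_rv (fun w => f (Z w)).
Proof.
by move=> mZ [M fM]; split; [exact: measurable_fun_nat|exists M => w].
Qed.

(** For f of bounded support, [f (Z w)] is a finite combination of indicators, so expectations
    follow from finite linearity without a limit. *)
Let indic_sum (Z : T -> nat) (f : nat -> R) K w : (forall k, (K <= k)%N -> f k = 0) ->
  f (Z w) = \sum_(0 <= k < K) f k * \1_(Z @^-1` [set k]) w.
Proof.
move=> f0; have [ZK|KZ] := ltnP (Z w) K; last first.
  rewrite f0 // big1_seq // => k; rewrite mem_index_iota => /andP[_ /andP[_ kK]].
  rewrite indicE memNset ?mulr0 //= => Zk.
  by move: KZ; rewrite Zk leqNgt kK.
rewrite (big_cat_nat (n := Z w)) //=; last exact: ltnW.
rewrite (big_ltn ZK) big1_seq => [|k]; last first.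
  rewrite mem_index_iota => /andP[_ kK].
  by rewrite indicE memNset ?mulr0 //= => Zk; move: kK; rewrite Zk ltnn.
rewrite big1_seq ?add0r => [|k]; last first.
  rewrite mem_index_iota => /andP[_ /andP[kK _]].
  by rewrite indicE memNset ?mulr0 //= => Zk; move: kK; rewrite Zk ltnn.
by rewrite indicE mem_set // mulr1 addr0.
Qed.

Let bounded_rv_indic (U : set T) : measurable U -> bounded_rv (\1_U : T -> R).
Proof.
move=> mU; split; first exact: measurable_indic.
by exists 1 => w; rewrite indicE; case: (_ \in _); rewrite ?normr1 ?normr0.
Qed.

Let Rintegral_indicator (U : set T) p : measurable U -> P U = p%:E ->
  \int[P]_w (\1_U w : R) = p.
Proof. by move=> mU PU; rewrite /Rintegral integral_indic // setIT (congr1 fine PU). Qed.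

Lemma Rintegral_nat (Z : T -> nat) (p f : nat -> R) (K : nat) :
  (forall k, measurable (Z @^-1` [set k])) ->
  (forall k, P (Z @^-1` [set k]) = (p k)%:E) ->
  (forall k, (K <= k)%N -> f k = 0) ->
  \int[P]_w f (Z w) = \sum_(0 <= k < K) f k * p k.
Proof.
move=> mZ pZ f0; under eq_Rintegral => w _ do rewrite (indic_sum _ _ f0).
rewrite Rintegral_bounded_sum => [|k]; last first.
  by apply: bounded_rvM; [exact: bounded_rv_cst|exact: bounded_rv_indic].
apply: eq_bigr => k _; rewrite Rintegral_boundedZ; last exact: bounded_rv_indic.
by rewrite (Rintegral_indicator (mZ k) (pZ k)).
Qed.

Lemma Rintegral_nat_indep (Z Z' : T -> nat) (p p' f f' : nat -> R) K K' :
  (forall k, measurable (Z @^-1` [set k])) ->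
  (forall k, measurable (Z' @^-1` [set k])) ->
  (forall k, P (Z @^-1` [set k]) = (p k)%:E) ->
  (forall k, P (Z' @^-1` [set k]) = (p' k)%:E) ->
  (forall k l, P (Z @^-1` [set k] `&` Z' @^-1` [set l]) = (p k * p' l)%:E) ->
  (forall k, (K <= k)%N -> f k = 0) -> (forall k, (K' <= k)%N -> f' k = 0) ->
  \int[P]_w (f (Z w) * f' (Z' w)) = (\int[P]_w f (Z w)) * \int[P]_w f' (Z' w).
Proof.
move=> mZ mZ' pZ pZ' pZZ' f0 f'0.
rewrite (Rintegral_nat mZ pZ f0) (Rintegral_nat mZ' pZ' f'0).
have bI k l : bounded_rv (fun w => f k * f' l * \1_(Z @^-1` [set k] `&` Z' @^-1` [set l]) w).
  apply: bounded_rvM; first exact: bounded_rv_cst.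
  by apply: bounded_rv_indic; exact: measurableI.
have E w : f (Z w) * f' (Z' w) = \sum_(0 <= k < K) \sum_(0 <= l < K')
    f k * f' l * \1_(Z @^-1` [set k] `&` Z' @^-1` [set l]) w.
  rewrite (indic_sum _ _ f0) (indic_sum _ _ f'0) big_distrlr /=.
  by apply: eq_bigr => k _; apply: eq_bigr => l _; rewrite indicI mulrACA.
under eq_Rintegral => w _ do rewrite E.
rewrite Rintegral_bounded_sum => [|k]; last exact: bounded_rv_sum.
rewrite big_distrlr /=; apply: eq_bigr => k _.
rewrite Rintegral_bounded_sum //; apply: eq_bigr => l _.
rewrite Rintegral_boundedZ; last by apply: bounded_rv_indic; exact: measurableI.
by rewrite (Rintegral_indicator _ (pZZ' k l)); [rewrite mulrACA|exact: measurableI].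
Qed.

(** The square is unbounded, so the integral is taken in the extended reals and split over the
    values of Z; every partial sum is at most [lam]. *)
Lemma integral_poisson_sqr_le (Z : T -> nat) (lam : R) : 0 <= lam ->
  (forall k, measurable (Z @^-1` [set k])) ->
  (forall k, P (Z @^-1` [set k]) = (poisson_weight lam k)%:E) ->
  (\int[P]_w (((Z w)%:R - lam) ^+ 2)%:E <= lam%:E)%E.
Proof.
move=> l0 mZ pZ; pose F k := Z @^-1` [set k].
have FT : \bigcup_k F k = setT by apply/seteqP; split=> // w _; exists (Z w).
have mf : measurable_fun setT (fun w => (((Z w)%:R - lam) ^+ 2)%:E : \bar R).
  exact: (measurable_fun_nat (fun k => ((k%:R - lam) ^+ 2)%:E)).
rewrite -FT ge0_integral_bigcup //; last 3 first.
- by rewrite FT.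
- by move=> w _; rewrite lee_fin sqr_ge0.
- by move=> i j _ _ [w [/= <- <-]].
have FE k : (\int[P]_(w in F k) (((Z w)%:R - lam) ^+ 2)%:E =
    ((k%:R - lam) ^+ 2 * poisson_weight lam k)%:E)%E.
  under eq_integral => w /[!inE] /= -> do [].
  by rewrite (integral_cst _ (mZ k)) [RHS]EFinM; congr (_ * _)%E; exact: pZ.
rewrite (eq_eseriesr (fun k _ => FE k)).
apply: lime_le => [|].
  by apply: is_cvg_nneseries => k _ _; rewrite lee_fin mulr_ge0 ?sqr_ge0 ?poisson_weight_ge0.
by apply: nearW => K; rewrite sumEFin lee_fin sum_poisson_weight_sqr_le.
Qed.

(** Carries the variance bound from the extended-real integral of the unbounded square to the real
    integral of a bounded function that it dominates. *)
Lemma Rintegral_poisson_sqr_le (Z : T -> nat) (lam : R) g (C : R) : 0 <= lam -> 0 <= C ->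
  (forall k, measurable (Z @^-1` [set k])) ->
  (forall k, P (Z @^-1` [set k]) = (poisson_weight lam k)%:E) ->
  bounded_rv (fun w => g (Z w)) -> (forall k, 0 <= g k <= C * (k%:R - lam) ^+ 2) ->
  \int[P]_w g (Z w) <= C * lam.
Proof.
move=> l0 C0 mZ pZ bg gC; rewrite -lee_fin -(expectation_bounded_rv P bg) unlock.
have mf : measurable_fun setT (fun w => (((Z w)%:R - lam) ^+ 2)%:E : \bar R).
  exact: (measurable_fun_nat (fun k => ((k%:R - lam) ^+ 2)%:E)).
apply: (@le_trans _ _ (\int[P]_w (C%:E * (((Z w)%:R - lam) ^+ 2)%:E))%E).
  apply: ge0_le_integral => //.
  - by move=> w _; rewrite lee_fin; case/andP: (gC (Z w)).
  - by apply/measurable_EFinP; case: bg.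
  - exact: emeasurable_funM.
  - by move=> w _; rewrite -EFinM lee_fin; case/andP: (gC (Z w)).
rewrite ge0_integralZl //; last by move=> w _; rewrite lee_fin sqr_ge0.
by rewrite EFinM lee_wpmul2l // ?lee_fin // integral_poisson_sqr_le.
Qed.

End DiscreteExpectation.

(** * Risk of the plug-in estimator *)

Section Hinge.
Context {R : realType}.
Implicit Types p L z lam : R.

Definition hinge p L z : R := Num.max (p - L * z) 0.

Lemma hinge_ge0 p L z : 0 <= hinge p L z.
Proof. by rewrite le_max lexx orbT. Qed.

Lemma hinge_le p L z : 0 <= p -> 0 <= L -> 0 <= z -> hinge p L z <= p.
Proof. by move=> p0 L0 z0; rewrite ge_max p0 andbT gerBl mulr_ge0. Qed.

Lemma hinge_lipschitz p L z lam :
  (hinge p L z - hinge p L lam) ^+ 2 <= L ^+ 2 * (z - lam) ^+ 2.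
Proof.
rewrite -exprMn -ler_sqrt ?sqr_ge0 // !sqrtr_sqr /hinge ler_norml.
by case: (leP (p - L * z) 0) => h1; case: (leP (p - L * lam) 0) => h2;
  case: (ler0P (L * (z - lam))) => h; apply/andP; split; lra.
Qed.

Lemma hinge_eventually0 p L k : 0 < L -> 0 <= p ->
  (Num.truncn (p / L) < k)%N -> hinge p L k%:R = 0.
Proof.
move=> L0 p0 pk; apply/max_idPr; rewrite subr_le0 -ler_pdivrMl // mulrC ltW //.
by rewrite (lt_le_trans (truncnS_gt _)) // ler_nat.
Qed.

(* When [L * lam <= 2 * p] this is the Lipschitz bound; otherwise the hinge
   vanishes at [lam], and it is at most [p] and positive only at distance at
   least [lam / 2] from [lam]. *)
Lemma hinge_sqr_dev p L lam : 0 <= p -> 0 < L -> 0 <= lam ->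
  exists C, [/\ 0 <= C, C * lam <= 2 * (p * L) &
    forall z, 0 <= z -> (hinge p L z - hinge p L lam) ^+ 2 <= C * (z - lam) ^+ 2].
Proof.
move=> p0 L0 l0; have [h|h] := lerP (L * lam) (2 * p).
  exists (L ^+ 2); split=> [||z _]; [exact: sqr_ge0| |exact: hinge_lipschitz].
  by rewrite expr2 -mulrA mulrA [leRHS]mulrA [leRHS]mulrC -mulrA ler_wpM2l // ltW.
have lp : 0 < lam.
  rewrite lt_neqAle l0 andbT; apply/eqP => l00; move: h; rewrite -l00 mulr0; lra.
exists (2 * (p * L) / lam); split=> [||z z0].
- by rewrite divr_ge0 // !mulr_ge0 // ltW.
- by rewrite divfK // gt_eqF.
have -> : hinge p L lam = 0 by apply/max_idPr; lra.
rewrite subr0 /hinge; have [h1|h1] := lerP (p - L * z) 0.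
  by rewrite expr0n /= mulr_ge0 ?sqr_ge0 // divr_ge0 // !mulr_ge0 // ltW.
have u0 : 0 <= L * z by rewrite mulr_ge0 // ltW.
apply: (@le_trans _ _ (p * (p - L * z))); first by rewrite expr2 ler_wpM2r; lra.
have -> : 2 * (p * L) / lam * (z - lam) ^+ 2 = p * (L * ((z - lam) ^+ 2 * (lam^-1 * 2))) by ring.
rewrite ler_wpM2l //.
(* With m = L lam and u = L z the claim becomes (p - u) m <= 2 (m - u)^2. It holds because u < p < m
   / 2 gives both m - u > m / 2 and m - u > p - u. *)
rewrite -(ler_pM2r (mulr_gt0 L0 lp)).
have -> : L * ((z - lam) ^+ 2 * (lam^-1 * 2)) * (L * lam) = 2 * (L * lam - L * z) ^+ 2.
  by field; rewrite gt_eqF.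
by move: h h1 u0; set u := L * z; set m := L * lam => h h1 u0; nra.
Qed.

End Hinge.

(** * Risk bounds for a fixed [Q] *)

Section HockeyStick.
Context {R : realType} {d : measure_display} {T : measurableType d} {S : nat}.
Variables (eps : R) (P Q : 'I_S -> R) (n : nat) (N : {mfun T >-> nat}).
Variables (X : nat -> T -> 'I_S) (Pr : probability T R).
Hypotheses (sP : simplex P) (sQ : simplex Q) (n0 : (0 < n)%N).
Hypothesis NXQ : poisson_sampling n N X Pr Q.

Let L : R := expR eps / n%:R.
Let Z i w := (\sum_(j < N w) (X j w == i))%N.
Let rate i : R := Num.min (P i) (Num.sqrt (expR eps * P i / n%:R)).

Let nR0 : 0 < n%:R :> R. Proof. by rewrite ltr0n. Qed.
Let L0 : 0 < L. Proof. by rewrite divr_gt0 ?expR_gt0. Qed.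
Let P0 i : 0 <= P i. Proof. by case: sP => + _; apply. Qed.
Let Q0 i : 0 <= Q i. Proof. by case: sQ => + _; apply. Qed.
Let lam0 i : 0 <= n%:R * Q i. Proof. by rewrite mulr_ge0. Qed.

Let rateE i : rate i = Num.min (P i) (Num.sqrt (L * P i)).
Proof. by rewrite /rate /L mulrAC. Qed.

Let empiricalE w :
  hockey_stick eps P (empirical n N X w) = \sum_i hinge (P i) L (Z i w)%:R.
Proof. by apply: eq_bigr => i _; rewrite /hinge /empirical /L mulrAC mulrA. Qed.

Let trueE : hockey_stick eps P Q = \sum_i hinge (P i) L (n%:R * Q i).
Proof.
apply: eq_bigr => i _; rewrite /hinge /L; congr (Num.max (_ - _) _).
by field; rewrite gt_eqF.
Qed.

Let mZ i k : measurable (Z i @^-1` [set k]) /\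
  Pr (Z i @^-1` [set k]) = (poisson_weight (n%:R * Q i) k)%:E.
Proof.
have [_ _ PrX _] := NXQ.
(* The marginal law is the case of an empty second kind: its count is 0, with Poisson weight 1. *)
have [|j|j|] := two_type_count_prob (A := pred1 i) (B := pred0) (al := Q i) (be := 0)
  NXQ _ _ _ k 0 n0.
- by move=> j /=; rewrite andbF.
- rewrite -(PrX j); congr (Pr (X j @^-1` _)); apply/seteqP; split=> x /=.
    by move/eqP.
  by move=> ->.
- by rewrite (_ : X j @^-1` _ = set0) ?measure0 //; apply/seteqP; split.
have -> : [set w | (\sum_(j < N w) pred1 i (X j w))%N = k /\
    (\sum_(j < N w) pred0 (X j w))%N = 0%N] = Z i @^-1` [set k].
  apply/seteqP; split=> w /=; first by case.
  by move=> Zk; split=> //; rewrite big1.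
move=> mE ->; split=> //.
by rewrite mulr0 {2}/poisson_weight oppr0 expR0 expr0 fact0 divr1 !mulr1.
Qed.

Let Zindep i j k l : i != j -> Pr (Z i @^-1` [set k] `&` Z j @^-1` [set l]) =
  (poisson_weight (n%:R * Q i) k * poisson_weight (n%:R * Q j) l)%:E.
Proof.
move=> ij; have [_ _ PrX _] := NXQ.
have [|m|m|_ <-//] := two_type_count_prob (A := pred1 i) (B := pred1 j) (al := Q i)
  (be := Q j) NXQ _ _ _ k l n0.
- by move=> x /=; apply/negP => /andP[/eqP -> /eqP ji]; rewrite ji eqxx in ij.
- rewrite -(PrX m); congr (Pr (X m @^-1` _)); apply/seteqP; split=> x /=.
    by move/eqP.
  by move=> ->.
- rewrite -(PrX m); congr (Pr (X m @^-1` _)); apply/seteqP; split=> x /=.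
    by move/eqP.
  by move=> ->.
Qed.

Let bounded_hinge i : bounded_rv (fun w => hinge (P i) L (Z i w)%:R).
Proof.
apply: (bounded_rv_nat (f := fun k => hinge (P i) L k%:R)) => [k|].
  by have [] := mZ i k.
by exists (P i) => k; rewrite ger0_norm ?hinge_ge0 // hinge_le // ltW.
Qed.

Lemma plugin_risk_le :
  ('E_Pr[fun w => (`|hockey_stick eps P (empirical n N X w) - hockey_stick eps P Q| ^+ 2)%R]
   <= (2 * ((\sum_i rate i) ^+ 2 + L))%:E)%E.
Proof.
pose c i := hinge (P i) L (n%:R * Q i).
pose D i w := hinge (P i) L (Z i w)%:R - c i.
have bD i : bounded_rv (D i).
  by apply: bounded_rvB => //; exact: bounded_rv_cst.
rewrite (_ : (fun w => _) = fun w => (\sum_i D i w) ^+ 2); last first.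
  by apply/funext => w; rewrite real_normK ?num_real // empiricalE trueE -sumrB.
rewrite expectation_bounded_rv; last first.
  by apply: bounded_rvM; exact: bounded_rv_sum.
rewrite lee_fin.
have DP i w : `|D i w| <= P i.
  have := hinge_ge0 (P i) L (Z i w)%:R; have := hinge_ge0 (P i) L (n%:R * Q i).
  have := hinge_le (P0 i) (ltW L0) (ler0n R (Z i w)).
  have := hinge_le (P0 i) (ltW L0) (lam0 i).
  rewrite /D /c ler_norml; lra.
have bD2 i : bounded_rv (fun w => D i w ^+ 2) by exact: bounded_rvM.
have D2 i : \int[Pr]_w (D i w ^+ 2) <= 2 * (P i * L).
  have [C [C0 Cl Cz]] := hinge_sqr_dev (P0 i) L0 (lam0 i).
  apply: le_trans Cl.
  apply: (Rintegral_poisson_sqr_le (g := fun k => (hinge (P i) L k%:R - c i) ^+ 2)) => //.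
  - by move=> k; have [] := mZ i k.
  - by move=> k; have [] := mZ i k.
  - exact: bD2.
  - by move=> k; rewrite sqr_ge0 Cz.
(* The variance bounds sum to 2 L because P has mass 1. The bias is at most [P i] and, by Jensen, at
   most sqrt (2 L P i), hence the factor sqrt 2. *)
apply: le_trans (@second_moment_sum_le _ _ _ Pr _ D (fun i => 2 * (P i * L))
  (fun i => Num.sqrt 2 * rate i) bD _ D2 _) _.
- move=> i j ij.
  have bh i' := bounded_hinge i'.
  have bc i' : bounded_rv (fun _ : T => c i') by exact: bounded_rv_cst.
  (* Shifted by [c i], the deviation [D i] need not vanish at large counts, whereas the hinge does.
     The product rule is therefore proved for hinges and carried to the deviations by expanding. *)
  have E : \int[Pr]_w (hinge (P i) L (Z i w)%:R * hinge (P j) L (Z j w)%:R) =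
      (\int[Pr]_w hinge (P i) L (Z i w)%:R) * \int[Pr]_w hinge (P j) L (Z j w)%:R.
    apply: (Rintegral_nat_indep (f := fun k => hinge (P i) L k%:R)
      (f' := fun k => hinge (P j) L k%:R)
      (p := poisson_weight (n%:R * Q i)) (p' := poisson_weight (n%:R * Q j))
      (K := (Num.truncn (P i / L)).+1) (K' := (Num.truncn (P j / L)).+1)).
    + by move=> k; have [] := mZ i k.
    + by move=> k; have [] := mZ j k.
    + by move=> k; have [] := mZ i k.
    + by move=> k; have [] := mZ j k.
    + by move=> k l; exact: Zindep.
    + by move=> k; exact: hinge_eventually0.
    + by move=> k; exact: hinge_eventually0.
  rewrite {3 4}/D !Rintegral_boundedB // !Rintegral_bounded_cst.
  have DE w : D i w * D j w = hinge (P i) L (Z i w)%:R * hinge (P j) L (Z j w)%:R -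
      (c j * hinge (P i) L (Z i w)%:R + (c i * hinge (P j) L (Z j w)%:R - c i * c j)).
    by rewrite /D; ring.
  under eq_Rintegral => w _ do rewrite DE.
  have b1 : bounded_rv (fun w => c j * hinge (P i) L (Z i w)%:R) by exact: bounded_rvM.
  have b2 : bounded_rv (fun w => c i * hinge (P j) L (Z j w)%:R) by exact: bounded_rvM.
  have b3 : bounded_rv (fun _ : T => c i * c j) by exact: bounded_rv_cst.
  have b4 := bounded_rvB b2 b3; have b5 := bounded_rvD b1 b4.
  have b6 := bounded_rvM (bh i) (bh j).
  rewrite (Rintegral_boundedB Pr b6 b5) E (Rintegral_boundedD Pr b1 b4).
  rewrite (Rintegral_boundedB Pr b2 b3) !Rintegral_boundedZ // Rintegral_bounded_cst.
  by ring.
- move=> i; rewrite rateE minr_pMr ?sqrtr_ge0 // le_min; apply/andP; split.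
    apply: (@le_trans _ _ (P i)).
      rewrite ler_norml; apply/andP; split.
        rewrite -(Rintegral_bounded_cst Pr (- P i)).
        apply: le_Rintegral_bounded => //; first exact: bounded_rv_cst.
        by move=> w; have := DP i w; rewrite ler_norml => /andP[].
      rewrite -(Rintegral_bounded_cst Pr (P i)).
      apply: le_Rintegral_bounded => //; first exact: bounded_rv_cst.
      by move=> w; have := DP i w; rewrite ler_norml => /andP[].
    by rewrite ler_peMl // -[leLHS]sqrtr1 ler_sqrt // ler1n.
  rewrite -sqrtrM // -sqrtr_sqr ler_sqrt; last by rewrite !mulr_ge0 // ltW.
  by rewrite (le_trans (sqr_Rintegral_le Pr (bD i))) // (mulrC L).
rewrite -!big_distrr /= -big_distrl /=; case: sP => _ ->.
by rewrite exprMn sqr_sqrtr // mul1r; lra.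
Qed.

(** For this [Q i] the kink of the hinge sits at the mean: P i = L lam, so the hinge is L
    [lam - Z]^+. Scaling lam /\ sqrt lam by L gives exactly [rate i], since L sqrt lam = sqrt (L P
    i). *)
Let mean_hinge_ge i : Q i = expR (- eps) * P i ->
  expR (-2) * rate i <= \int[Pr]_w hinge (P i) L (Z i w)%:R.
Proof.
move=> Qi; set lam := n%:R * Q i.
have lamE : P i = L * lam.
  rewrite /lam Qi /L expRN; field; rewrite gt_eqF ?expR_gt0 //= gt_eqF //.
rewrite (Rintegral_nat (f := fun k => hinge (P i) L k%:R) (K := (Num.truncn lam).+1)
  (p := poisson_weight lam)).
- have -> : \sum_(0 <= k < (Num.truncn lam).+1) hinge (P i) L k%:R * poisson_weight lam k =
      L * \sum_(0 <= k < (Num.truncn lam).+1) (lam - k%:R) * poisson_weight lam k.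
    rewrite big_distrr; apply: eq_big_nat => k /andP[_ kl] /=.
    rewrite mulrA; congr (_ * _); rewrite /hinge lamE -mulrBr; apply/max_idPl.
    by rewrite mulr_ge0 ?(ltW L0) // subr_ge0 -(truncn_ge_nat _ (lam0 i)).
  apply: le_trans (_ : L * (expR (-2) * Num.min lam (Num.sqrt lam)) <= _); last first.
    by rewrite ler_wpM2l ?(ltW L0) //; exact: poisson_mean_dev_ge (lam0 i).
  rewrite mulrCA ler_wpM2l ?expR_ge0 // rateE minr_pMr ?(ltW L0) // -lamE.
  rewrite lamE mulrA -expr2 sqrtrM ?sqr_ge0 // sqrtr_sqr gtr0_norm //.
- by move=> k; have [] := mZ i k.
- by move=> k; have [] := mZ i k.
- move=> k kl; apply: hinge_eventually0 => //; rewrite lamE mulrC mulrA mulVf ?mul1r //.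
  by rewrite gt_eqF.
Qed.

Lemma plugin_risk_ge (i0 : 'I_S) :
  (forall i, expR (- eps) * P i <= Q i) ->
  (forall i, i != i0 -> Q i = expR (- eps) * P i) ->
  (((expR (-2) * \sum_(i | i != i0) rate i) ^+ 2)%:E <=
  'E_Pr[fun w => (`|hockey_stick eps P (empirical n N X w) - hockey_stick eps P Q| ^+ 2)%R])%E.
Proof.
move=> PQ Qi.
have trueE0 : hockey_stick eps P Q = 0.
  rewrite /hockey_stick big1 // => i _; apply/max_idPr; rewrite subr_le0.
  by rewrite -ler_pdivrMl ?expR_gt0 // -expRN.
pose F w := \sum_i hinge (P i) L (Z i w)%:R.
have bF : bounded_rv F by exact: bounded_rv_sum.
rewrite (_ : (fun w => _) = fun w => F w ^+ 2); last first.
  by apply/funext => w; rewrite real_normK ?num_real // empiricalE trueE0 subr0.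
rewrite expectation_bounded_rv; last exact: bounded_rvM.
rewrite lee_fin (le_trans _ (sqr_Rintegral_le Pr bF)) //.
have rate0 i : 0 <= rate i by rewrite le_min P0 sqrtr_ge0.
rewrite ler_sqr ?nnegrE ?mulr_ge0 ?expR_ge0 ?sumr_ge0 //; last first.
  by apply: Rintegral_ge0 => w _; rewrite sumr_ge0 // => i _; exact: hinge_ge0.
(* The mean at [i0] is only known to be nonnegative and is dropped. *)
rewrite Rintegral_bounded_sum // [leRHS](bigD1 i0) //= -[leLHS]add0r lerD //.
  by apply: Rintegral_ge0 => w _; exact: hinge_ge0.
by rewrite big_distrr; apply: ler_sum => i ii0; rewrite mean_hinge_ge // Qi.
Qed.

End HockeyStick.

(** * Worst-case risk over the simplex *)

Theorem theorem1 (R : realType) :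
  exists A a : R, [/\ 0 < A, 0 < a &
    forall (eps : R) (S : nat) (P : 'I_S -> R) (n : nat)
      (d : measure_display) (T : measurableType d)
      (N : {mfun T >-> nat}) (X : nat -> T -> 'I_S)
      (Pr : ('I_S -> R) -> probability T R),
    0 <= eps -> (0 < S)%N -> simplex P -> (0 < n)%N ->
    (forall Q : 'I_S -> R, simplex Q -> poisson_sampling n N X (Pr Q) Q) ->
    let worst_risk : \bar R :=
      ereal_sup
        [set 'E_(Pr Q)[fun w : T =>
               (`|hockey_stick eps P (empirical n N X w)
                  - hockey_stick eps P Q| ^+ 2)%R]%E | Q in simplex] in
    let rate : R :=
      \sum_(i < S) Num.min (P i) (Num.sqrt (expR eps * P i / n%:R)) in
    (worst_risk <= (A * (rate ^+ 2 + expR eps / n%:R))%:E)%E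
    /\ ((2 <= S)%N -> ((a * rate ^+ 2)%:E <= worst_risk)%E)].
Proof.
(* The factor e^-2 comes from [poisson_mean_dev_ge], the factor 1/2 from discarding the smallest
   term of the rate. *)
exists 2, ((expR (-2) / 2) ^+ 2); split=> //.
move=> eps S P n d T N X Pr eps0 S0 sP n0 NXQ /=; split.
  by apply: ge_ereal_sup => _ [Q sQ <-]; apply: plugin_risk_le => //; exact: NXQ.
move=> S2; have [P0 P1] := sP.
pose i0 := [arg min_(i < Ordinal S0) P i]%O.
have i0min j : P i0 <= P j.
  by rewrite /i0; case: arg_minP => // i _; apply.
have e1 : expR (- eps) <= 1 by rewrite expR_le1 oppr_le0.
(* The value at [i0] makes the total mass 1; it is at least [expR (- eps) * P i0] because
   [eps >= 0]. *)
pose Q i := if i == i0 then 1 - expR (- eps) * (1 - P i0) else expR (- eps) * P i.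
have PQ i : expR (- eps) * P i <= Q i.
  by rewrite /Q; case: eqP => [->|_] //; lra.
have Qi i : i != i0 -> Q i = expR (- eps) * P i by rewrite /Q => /negbTE ->.
have sQ : simplex Q.
  split=> [i|]; first by apply: le_trans (PQ i); rewrite mulr_ge0 ?expR_ge0.
  rewrite (bigD1 i0) //= (eq_bigr _ Qi) -big_distrr /= /Q eqxx.
  by move: P1; rewrite (bigD1 i0) //= => <-; ring.
apply: le_trans (ereal_sup_ubound (ex_intro2 _ _ Q sQ erefl)).
apply: le_trans (plugin_risk_ge sP sQ n0 (NXQ _ sQ) PQ Qi).
pose r i := Num.min (P i) (Num.sqrt (expR eps * P i / n%:R)).
rewrite lee_fin -exprMn.
change ((expR (-2) / 2 * \sum_i r i) ^+ 2 <= (expR (-2) * \sum_(i | i != i0) r i) ^+ 2).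
have r0 i : 0 <= r i by rewrite le_min P0 sqrtr_ge0.
rewrite ler_sqr ?nnegrE ?mulr_ge0 ?expR_ge0 ?sumr_ge0 ?invr_ge0 //.
rewrite -mulrA ler_wpM2l ?expR_ge0 // ler_pdivrMl // (bigD1 i0) //=.
(* As [S >= 2] there is another index j, and the terms of the rate are monotone in p; so the term at
   [i0] is at most that at j, hence at most the sum over the indices other than [i0]. *)
have [j ji0] : exists j, j != i0.
  pose k := Ordinal S2; have [ki0|] := eqVneq k i0; last by exists k.
  by exists (Ordinal S0); rewrite -ki0.
have : r i0 <= r j.
  rewrite /r le_min !ge_min i0min /=; apply/orP; right.
  rewrite ler_wsqrtr // ler_pM2r ?invr_gt0 ?ltr0n // ler_wpM2l ?expR_ge0 //.
have : r j <= \sum_(i | i != i0) r i.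
  by rewrite (bigD1 j) //= lerDl sumr_ge0.
lra.
Qed.
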